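(* Let $X$ be an infinite-dimensional normed space and $\mathcal{F}$ a free filter on $\mathbb{N}$. (a) If the uniform $\mathcal{F}$-boundedness principle holds for $X$, then $\mathcal{F}$ is a P$^+$-filter. (b) If the stationary uniform $\mathcal{F}$-boundedness principle holds for $X$, then $\mathcal{F}$ is a weak P$^+$-filter.
   Context: $\mathbb{N}=\{0,1,2,\ldots\}$. A filter on $\mathbb{N}$ is a non-empty, upwards closed family $\mathcal{F}\subsetneq P(\mathbb{N})$ closed under finite intersections; it is free if it contains all cofinite subsets of $\mathbb{N}$. A set $A\subseteq\mathbb{N}$ is $\mathcal{F}$-stationary if $\mathbb{N}\setminus A\notin\mathcal{F}$. $(\forall_{\mathcal{F}}\, i\in\mathbb{N})\,\Phi(i)$ means $\{i\in\mathbb{N}:\Phi(i)\}\in\mathcal{F}$. $A\subseteq^* B$ means $A\setminus B$ is finite. $\mathcal{F}$ is a weak P$^+$-filter if for every decreasing sequence $(A_k)_k$ of sets in $\mathcal{F}$ and every $\mathcal{F}$-stationary set $I$ there is an $\mathcal{F}$-stationary set $B\subseteq I$ with $B\subseteq^* A_k$ for every $k$. $\mathcal{F}$ is a P$^+$-filter if for every decreasing sequence $(A_k)_k$ of $\mathcal{F}$-stationary sets there is an $\mathcal{F}$-stationary set $B$ with $B\subseteq^* A_k$ for every $k$. For topological vector spaces $X,Y$, $\mathcal{L}(X,Y)$ is the space of continuous linear maps. A sequence $(y_i)_i$ in $Y$ is $\mathcal{F}$-bounded if for every $0$-neighbourhood $V$ in $Y$ there is $t>0$ with $ty_i\in V$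 $(\forall_{\mathcal{F}}\, i\in\mathbb{N})$. A sequence $(T_i)_i$ in $\mathcal{L}(X,Y)$ is pointwise $\mathcal{F}$-bounded if $(T_i(x))_i$ is $\mathcal{F}$-bounded for every $x\in X$. It is $\mathcal{F}$-equicontinuous if for every $0$-neighbourhood $V$ in $Y$ there is a $0$-neighbourhood $U$ in $X$ with $T_i[U]\subseteq V$ $(\forall_{\mathcal{F}}\, i\in\mathbb{N})$. It is $\mathcal{F}$-stationary-equicontinuous if for every $\mathcal{F}$-stationary set $I$ and every $0$-neighbourhood $V$ in $Y$ there are a $0$-neighbourhood $U$ in $X$ and an $\mathcal{F}$-stationary set $J\subseteq I$ with $T_i[U]\subseteq V$ for all $i\in J$. The uniform (resp. stationary uniform) $\mathcal{F}$-boundedness principle holds for $X$ if for every locally convex space $Y$, every pointwise $\mathcal{F}$-bounded sequence in $\mathcal{L}(X,Y)$ is $\mathcal{F}$-equicontinuous (resp. $\mathcal{F}$-stationary-equicontinuous). *)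

(* Defs.v *)
From HB Require Import structures.
From mathcomp Require Import all_boot all_order all_algebra.
From mathcomp Require Import all_classical all_reals all_analysis.
From mathcomp Require Import complex.

Set Implicit Arguments.
Unset Strict Implicit.
Unset Printing Implicit Defensive.

Import Order.TTheory GRing.Theory Num.Theory.
Import numFieldNormedType.Exports.

Local Open Scope classical_set_scope.
Local Open Scope ring_scope.

Definition free_filter (F : set_system nat) : Prop :=
  forall A : set nat, finite_set (~` A) -> F A.

Definition stationary (F : set_system nat) (A : set nat) : Prop :=
  ~ F (~` A).

Definition almost_subset (A B : set nat) : Prop := finite_set (A `\` B).

Definition decreasing_sets (A : nat -> set nat) : Prop :=
  forall k, A k.+1 `<=` A k.

Definition weak_Pplus_filter (F : set_system nat) : Prop :=
  forall A : nat -> set nat, decreasing_sets A -> (forall k, F (A k)) ->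
  forall I : set nat, stationary F I ->
  exists B : set nat,
    [/\ stationary F B, B `<=` I & forall k, almost_subset B (A k)].

Definition Pplus_filter (F : set_system nat) : Prop :=
  forall A : nat -> set nat, decreasing_sets A ->
  (forall k, stationary F (A k)) ->
  exists B : set nat, stationary F B /\ forall k, almost_subset B (A k).

(* In a [numFieldType], [0 < t] forces [t] to be real, so when [K] is the
   complex field the scalar [t] below ranges over the positive reals. *)
Definition filter_bounded (K : numFieldType) (Y : topologicalLmodType K)
    (F : set_system nat) (y : nat -> Y) : Prop :=
  forall V : set Y, nbhs (0 : Y) V ->
  exists2 t : K, 0 < t & \forall i \near F, V (t *: y i).

Definition pointwise_filter_bounded (K : numFieldType)
    (X Y : topologicalLmodType K) (F : set_system nat)
    (T : nat -> {linear X -> Y}) : Prop :=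
  forall x : X, filter_bounded F (fun i => T i x).

Definition filter_equicontinuous (K : numFieldType)
    (X Y : topologicalLmodType K) (F : set_system nat)
    (T : nat -> {linear X -> Y}) : Prop :=
  forall V : set Y, nbhs (0 : Y) V ->
  exists2 U : set X, nbhs (0 : X) U & \forall i \near F, T i @` U `<=` V.

Definition filter_stationary_equicontinuous (K : numFieldType)
    (X Y : topologicalLmodType K) (F : set_system nat)
    (T : nat -> {linear X -> Y}) : Prop :=
  forall (I : set nat) (V : set Y), stationary F I -> nbhs (0 : Y) V ->
  exists (U : set X) (J : set nat),
    [/\ nbhs (0 : X) U, stationary F J, J `<=` I &
        forall i, J i -> T i @` U `<=` V].

(* [topologicalLmodType K] is the type of all topological vector spaces;
   the library's [tvsType K] is the type of the locally convex ones. *)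
Definition uniform_boundedness_principle (K : numFieldType)
    (X : topologicalLmodType K) (F : set_system nat) : Prop :=
  forall (Y : tvsType K) (T : nat -> {linear X -> Y}),
  (forall i, continuous (T i)) ->
  pointwise_filter_bounded F T -> filter_equicontinuous F T.

Definition stationary_uniform_boundedness_principle (K : numFieldType)
    (X : topologicalLmodType K) (F : set_system nat) : Prop :=
  forall (Y : tvsType K) (T : nat -> {linear X -> Y}),
  (forall i, continuous (T i)) ->
  pointwise_filter_bounded F T -> filter_stationary_equicontinuous F T.

Definition finite_dimensional (K : numFieldType) (X : lmodType K) : Prop :=
  exists (n : nat) (v : 'I_n -> X),
  forall x : X, exists a : 'I_n -> K, x = \sum_(i < n) a i *: v i.

(* Main.v *)
Require Import Defs.
From HB Require Import structures.
From mathcomp Require Import all_boot all_order all_algebra.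
From mathcomp Require Import all_classical all_reals all_analysis.
From mathcomp Require Import complex.
From mathcomp Require Import ring lra zify.

Set Implicit Arguments.
Unset Strict Implicit.
Unset Printing Implicit Defensive.

Import Order.TTheory GRing.Theory Num.Theory.
Import numFieldNormedType.Exports.

Local Open Scope classical_set_scope.
Local Open Scope ring_scope.

(* Both parts rest on functionals f on X of norm at least k such that, along a
   sequence of them, limsup |f_n(x)| <= 2 |x| for every x: placing such a
   sequence on the k-th layer A_k \ A_(k+1) gives operators whose set of large
   values at any x meets each layer in a finite set, while their norms tend to
   infinity along the layers.

   Such functionals exist by an approximate form of the Josefson-Nissenzweig
   theorem. Suppose that it fails for eps, so that every sequence of functionals
   of norm >= 1 has absolute values > eps infinitely often at some point of the
   unit ball. Take functionals f_n in the dual ball at mutual distance >= 1. By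
   Ramsey's theorem, along a subsequence the alternating sums of 2^(k+1)
   functionals with increasing, sufficiently large indices have norm at least
   2^k eps. This produces points x_k of the unit ball and a binary tree
   of infinite index sets, such that at x_k the two children of the nodes of
   level k differ on average by a fixed positive amount. The Rademacher averages
   of the f_n along the tree, and then their limit along an ultrafilter, give
   functionals L_k with L_k(x_k) bounded below and, by Bessel's inequality,
   sum_k L_k(x)^2 <= |x|^2, so that L_k(x) tends to 0 for every x: a
   contradiction. *)

(** * Hahn-Banach functionals *)

Section Sublinear.
Variables (R : realType) (V : lmodType R).
Implicit Types (x y : V).

Definition sublinear (q : V -> R) :=
  (forall x y, q (x + y) <= q x + q y) /\
  (forall t x, 0 < t -> q (t *: x) <= t * q x).

Lemma sublinear0 (q : V -> R) : sublinear q -> q 0 = 0.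
Proof.
move=> [qD qZ]; apply/eqP; rewrite eq_le; apply/andP; split.
  have := qZ (2^-1) 0 ltac:(lra).
  by rewrite scaler0 => ?; lra.
by have := qD 0 0; rewrite addr0 => ?; lra.
Qed.

Lemma sublinearZ (q : V -> R) t x :
  sublinear q -> 0 <= t -> q (t *: x) = t * q x.
Proof.
move=> qs; rewrite le_eqVlt => /predU1P[<-|t0].
  by rewrite scale0r mul0r sublinear0.
apply/eqP; rewrite eq_le qs.2//=.
have := qs.2 t^-1 (t *: x); rewrite invr_gt0 => /(_ t0).
by rewrite scalerA mulVf ?gt_eqF// scale1r mulrC ler_pdivlMr// mulrC.
Qed.

Lemma sublinear_ge (q : V -> R) x : sublinear q -> - q (- x) <= q x.
Proof.
move=> qs; have := qs.1 x (- x).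
by rewrite subrr sublinear0// => ?; lra.
Qed.

(** [q' x] is the infimum of [q (x + t *: y) - t * q y] over [t >= 0]: [t = 0] gives [q' <= q], and
    [t = 1] at [x = - y] gives the last bound. *)
Lemma sublinear_slide (q : V -> R) y : sublinear q ->
  exists q', [/\ sublinear q', forall x, q' x <= q x & q' (- y) <= - q y].
Proof.
move=> qs.
pose A x := [set q (x + t *: y) - t * q y | t in [set t | 0 <= t]].
have lbA x : has_lbound (A x).
  exists (- q (- x)) => _ [t /= t0 <-].
  have := qs.1 (x + t *: y) (- x).
  rewrite addrAC subrr add0r (sublinearZ _ qs)// => ?; lra.
have infA x t : 0 <= t -> inf (A x) <= q (x + t *: y) - t * q y.
  by move=> t0; apply: ge_inf => //; exists t.
have A0 x : A x !=set0 by exists (q (x + 0 *: y) - 0 * q y), 0 => //=.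
exists (fun x => inf (A x)); split; last 2 first.
- by move=> x; have := infA x 0 (lexx _); rewrite scale0r addr0 mul0r subr0.
- have := infA (- y) 1 ler01.
  by rewrite scale1r addNr (sublinear0 qs) mul1r sub0r.
split=> [x1 x2|a x a0].
- rewrite -lerBlDr; apply: lb_le_inf => // _ [s /= s0 <-].
  rewrite lerBlDr -lerBlDl; apply: lb_le_inf => // _ [t /= t0 <-].
  have := infA (x1 + x2) (s + t) (addr_ge0 s0 t0).
  have := qs.1 (x1 + s *: y) (x2 + t *: y).
  by rewrite addrACA -scalerDl => ? ?; lra.
- rewrite mulrC -ler_pdivrMr//; apply: lb_le_inf => // _ [t /= t0 <-].
  rewrite ler_pdivrMr//.
  apply: le_trans (infA (a *: x) (a * t) (mulr_ge0 (ltW a0) t0)) _.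
  rewrite -scalerA -scalerDr (sublinearZ _ qs (ltW a0)).
  by rewrite le_eqVlt; apply/predU1P; left; ring.
Qed.

(* A minimal sublinear functional is linear, by [sublinear_slide]. *)
Lemma sublinear_dominates (p : V -> R) : sublinear p ->
  exists f : V -> R, scalar f /\ forall x, f x <= p x.
Proof.
move=> ps.
pose P (q : V -> R) := sublinear q /\ forall x, q x <= p x.
pose T := {q : V -> R | P q}.
(* The order is reversed, so a maximal element is a pointwise minimal functional. A nonempty chain
   is bounded by its pointwise infimum, the empty one by [p]. *)
pose le (q r : T) : bool := `[< forall x, sval r x <= sval q x >].
have [||||[q [qs qp]] qmin] := @Zorn T le.
- by move=> q; apply/asboolP => x.
- move=> q r s /asboolP qr /asboolP rs; apply/asboolP => x.
  exact: le_trans (rs x) (qr x).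
- move=> [q Pq] [r Pr] /asboolP /= qr /asboolP /= rq.
  apply: eq_exist => /=; apply/funext => x.
  by apply/eqP; rewrite eq_le qr rq.
- move=> A Atot; have [[q0 Aq0]|A0] := pselect (A !=set0); last first.
    exists (exist P p (conj ps (fun x => lexx _))) => s As.
    by case: A0; exists s.
  pose B x := [set sval q x | q in A].
  have lbB x : has_lbound (B x).
    exists (- p (- x)) => _ [[q [qs qp]] _ /= <-].
    by apply: le_trans (sublinear_ge x qs); rewrite lerN2.
  have B0 x : B x !=set0 by exists (sval q0 x), q0.
  have infB x q : A q -> inf (B x) <= sval q x.
    by move=> Aq; apply: ge_inf => //; exists q.
  have infs : sublinear (fun x => inf (B x)).
    split=> [x y|t x t0].
    - rewrite -lerBlDr; apply: lb_le_inf => // _ [q Aq <-].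
      rewrite lerBlDr -lerBlDl; apply: lb_le_inf => // _ [r Ar <-].
      have [|] := Atot _ _ Aq Ar => /asboolP le_qr.
      + have := infB (x + y) r Ar; have := (svalP r).1.1 x y.
        by have := le_qr x => ? ? ?; lra.
      + have := infB (x + y) q Aq; have := (svalP q).1.1 x y.
        by have := le_qr y => ? ? ?; lra.
    - rewrite mulrC -ler_pdivrMr//; apply: lb_le_inf => // _ [q Aq <-].
      rewrite ler_pdivrMr// mulrC.
      exact: le_trans (infB _ _ Aq) ((svalP q).1.2 _ _ t0).
  have infp x : inf (B x) <= p x.
    exact: le_trans (infB x _ Aq0) ((svalP q0).2 x).
  exists (exist P _ (conj infs infp)) => q Aq.
  by apply/asboolP => x /=; apply: infB.
have qN y : q (- y) = - q y.
  have [r [rs rq ry]] := sublinear_slide y qs.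
  have rp x : r x <= p x := le_trans (rq x) (qp x).
  have /(congr1 sval)/= qr := qmin (exist P r (conj rs rp)) (asboolT rq).
  apply/eqP; rewrite eq_le -{1}qr ry/= lerNl -{2}(opprK y).
  by have := sublinear_ge (- y) qs; lra.
have qZ t x : q (t *: x) = t * q x.
  have [t0|t0] := leP 0 t; first exact: sublinearZ.
  rewrite -[t]opprK scaleNr qN (sublinearZ _ qs) ?oppr_ge0 ?ltW//; lra.
exists q; split=> // a x y.
rewrite -qZ; apply/eqP; rewrite eq_le qs.1/=.
have := qs.1 (- (a *: x)) (- y); rewrite -opprD !qN => ?; lra.
Qed.

(** Sliding [p] along [e] first gives [q <= p] with [q (- e) <= - p e], so any linear [f <= q] has
    [f e >= p e]. *)
Lemma norming_functional (p : V -> R) e : sublinear p ->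
  exists f : V -> R, [/\ scalar f, forall x, f x <= p x & f e = p e].
Proof.
move=> ps; have [q [qs qp qe]] := sublinear_slide e ps.
have [f [fl fq]] := sublinear_dominates qs; exists f.
have fp x : f x <= p x := le_trans (fq x) (qp x).
split=> //; apply/eqP; rewrite eq_le fp/=.
have f0 : f 0 = 0 by have := fl 1 0 0; rewrite scale1r addr0 => ?; lra.
have := fl (-1) e e; rewrite scaleN1r addNr f0.
have := fl (-1) e 0; rewrite scaleN1r addr0 f0.
by have := fq (- e); lra.
Qed.

End Sublinear.

(** * Infinite sets of indices and Ramsey's theorem *)

Lemma homo_ltnS (u : nat -> nat) :
  (forall i, (u i < u i.+1)%N) -> {homo u : i j / (i < j)%N}.
Proof.
by apply: (@homo_ltn _ u (fun x y => (x < y)%N)) => y x z /ltn_trans; apply.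
Qed.

Definition unbounded (A : set nat) := forall n, exists2 m, (n <= m)%N & A m.

Lemma unboundedU (A B : set nat) :
  unbounded (A `|` B) -> unbounded A \/ unbounded B.
Proof.
move=> AB; have [|/existsNP[b bA]] := pselect (unbounded A); first by left.
right=> n; have [m mn [Am|Bm]] := AB (maxn n b).
  by case: bA; exists m => //; rewrite (leq_trans _ mn)// leq_maxr.
by exists m => //; rewrite (leq_trans _ mn)// leq_maxl.
Qed.

Lemma unboundedS (A B : set nat) : A `<=` B -> unbounded A -> unbounded B.
Proof. by move=> AB uA n; have [m nm /AB] := uA n; exists m. Qed.

Lemma unbounded_tail (A : set nat) b :
  unbounded A -> unbounded (A `&` [set m | (b <= m)%N]).
Proof.
move=> uA n; have [m + Am] := uA (maxn n b); rewrite geq_max => /andP[nm bm].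
by exists m.
Qed.

Lemma unbounded_chain (P : nat -> set nat) : (forall k, unbounded (P k)) ->
  exists u : nat -> nat, {homo u : i j / (i < j)%N} /\ forall k, P k (u k).
Proof.
move=> uP; pose S := (nat * nat)%type.
have step (z : S) : {w : S | [/\ w.1 = z.1.+1, (z.2 < w.2)%N & P z.1 w.2]}.
  by apply: cid; have [m zm Pm] := uP z.1 z.2.+1; exists (z.1.+1, m).
have [F [F0 FS]] := dependent_choice step (0, 0)%N.
have F1 n : (F n).1 = n.
  by elim: n => [|n IH]; [rewrite F0 | have [-> _ _] := FS n; rewrite IH].
exists (fun k => (F k.+1).2); split=> [|k].
  by refine (@homo_ltnS (fun k => (F k.+1).2) _) => i; have [] := FS i.+1.
by have [_ _] := FS k; rewrite F1.
Qed.

Lemma unbounded_enum (A : set nat) : unbounded A ->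
  exists u : nat -> nat, {homo u : i j / (i < j)%N} /\ forall k, A (u k).
Proof. by move=> uA; exact: (@unbounded_chain (fun=> A)). Qed.

Lemma increasing_ge (u : nat -> nat) :
  {homo u : i j / (i < j)%N} -> forall k, (k <= u k)%N.
Proof.
by move=> uh; elim=> // k IH; apply: leq_ltn_trans IH (uh _ _ (ltnSn k)).
Qed.

(** The [r]-element subsets of [A] are encoded as strictly increasing lists, coloured by [P] and its
    complement. *)
Definition chains_in (A : set nat) (r : nat) (P : set (seq nat)) :=
  forall s, sorted ltn s -> size s = r -> (forall i, i \in s -> A i) -> P s.

Lemma chains_inS (A B : set nat) r P :
  A `<=` B -> chains_in B r P -> chains_in A r P.
Proof. by move=> AB H s ss sr sA; apply: H => // i /sA /AB. Qed.

(** Induction on [r]. Elements [a n] are picked one by one, each time thinning the reservoir so that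
    the colour of [a n :: s] is the same for all chains [s] of length [r] in it. One colour occurs
    for infinitely many [n], and these [a n] form the homogeneous set. *)
Lemma ramsey r (P : set (seq nat)) (A : set nat) : unbounded A ->
  exists B, [/\ B `<=` A, unbounded B &
    chains_in B r P \/ chains_in B r (~` P)].
Proof.
elim: r P A => [|r IH] P A uA.
  exists A; split=> //; have [P0|P0] := pselect (P [::]); [left|right];
  by move=> s _ /size0nil -> _.
pose S := (nat * {B : set nat | unbounded B})%type.
pose good (z : S) (Q : set (seq nat)) :=
  chains_in (sval z.2) r [set s | Q (z.1 :: s)].
have step (z : S) : {w : S | [/\ sval z.2 w.1,
    sval w.2 `<=` sval z.2 `&` [set m | (w.1 < m)%N] &
    good w P \/ good w (~` P)]}.
  apply: cid; case: z => k [B uB] /=; have [a _ Ba] := uB 0%N.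
  have [C [CB uC hC]] := IH [set s | P (a :: s)] _ (unbounded_tail a.+1 uB).
  by exists (a, exist _ C uC); split.
have [F [F0 FS]] := dependent_choice step (0%N, exist _ A uA).
(* The head of the initial state is a dummy, hence the shift by one. *)
pose a n := (F n.+1).1; pose B n := sval (F n.+1).2.
have aB n d : B (n + d)%N `<=` B n /\ B n (a (n + d).+1).
  have BS m : B m.+1 `<=` B m.
    by move=> i; have [_ + _] := FS m.+1 => /[apply] -[].
  have Bd : B (n + d)%N `<=` B n.
    by elim: d => [|d IHd]; rewrite ?addn0// addnS; apply: subset_trans IHd.
  by split=> //; apply: Bd; have [] := FS (n + d).+1.
have BA n : B n `<=` A.
  apply: subset_trans (aB 0%N n).1 _.
  by rewrite /B; have [_ + _] := FS 0%N; rewrite F0 => + i => /[apply] -[].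
have ah : {homo a : i j / (i < j)%N}.
  apply/homo_ltnS => n; have [+ _ _] := FS n.+1; rewrite -/(a n.+1).
  by have [_ + _] := FS n => /[apply] -[].
have aA n : A (a n).
  case: n => [|n]; last by apply: (BA n); have [_] := aB n 0%N; rewrite addn0.
  by rewrite /a; have [+ _ _] := FS 0%N; rewrite F0.
suff main (Q : set (seq nat)) : unbounded [set n | good (F n.+1) Q] ->
    exists C, [/\ C `<=` A, unbounded C & chains_in C r.+1 Q].
  have [|/main|/main] := @unboundedU [set n | good (F n.+1) P]
      [set n | good (F n.+1) (~` P)].
  - by move=> n; exists n => //; have [] := FS n.
  - by move=> [C [CA uC CP]]; exists C; split; [| |left].
  - by move=> [C [CA uC CP]]; exists C; split; [| |right].
move=> uQ; exists [set a n | n in [set n | good (F n.+1) Q]]; split.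
- by move=> _ [n _ <-].
- move=> n; have [m nm Qm] := uQ n; exists (a m); last by exists m.
  exact: leq_trans nm (increasing_ge ah m).
move=> [//|i s] /=; rewrite (path_sortedE ltn_trans) => /andP[/allP si ss] [sr].
move=> sC; have [n nQ ni] := sC i (mem_head _ _).
rewrite -ni; apply: nQ => // j js.
have [m _ mj] : [set a n | n in [set n | good (F n.+1) Q]] j.
  by apply: sC; rewrite inE js orbT.
have nm : (n < m)%N.
  have := si _ js; rewrite -ni -mj ltnNge leq_eqVlt ltnNge => nm.
  rewrite ltnNge leq_eqVlt; apply/negP => /predU1P[mn|mn].
    by move: nm; rewrite mn eqxx.
  by move: nm; rewrite -ltnNge ah ?orbT.
by have [_] := aB n (m - n.+1)%N; rewrite -addSn subnKC// mj.
Qed.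

(** Thin the set for [Q 0], [Q 1], ... in turn and take a diagonal sequence: it lies in the set
    obtained for [Q k] from its term [k.+1] on. *)
Lemma unbounded_diagonal (Q : nat -> set (set nat)) :
  (forall k B C, B `<=` C -> Q k C -> Q k B) ->
  (forall k A, unbounded A -> exists B, [/\ B `<=` A, unbounded B & Q k B]) ->
  exists M, unbounded M /\
    forall k, exists b, Q k (M `&` [set m | (b <= m)%N]).
Proof.
move=> QS HQ; pose S := (nat * {B : set nat | unbounded B})%type.
have step (z : S) : {w : S | [/\ w.1 = z.1.+1,
    sval w.2 `<=` sval z.2 & Q z.1 (sval w.2)]}.
  apply: cid; case: z => k [B uB] /=; have [C [CB uC QC]] := HQ k B uB.
  by exists (k.+1, exist _ C uC).
have uT : unbounded setT by move=> n; exists n.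
have [F [F0 FS]] := dependent_choice step (0%N, exist _ _ uT).
have F1 n : (F n).1 = n.
  by elim: n => [|n IH]; [rewrite F0 | have [-> _ _] := FS n; rewrite IH].
have FD n d : sval (F (n + d)%N).2 `<=` sval (F n).2.
  elim: d => [|d IHd]; rewrite ?addn0// addnS; apply: subset_trans IHd.
  by have [] := FS (n + d)%N.
have [u [uh uF]] := @unbounded_chain (fun k => sval (F k).2)
  (fun k => svalP (F k).2).
exists (range u); split=> [n|k].
  by exists (u n); [exact: increasing_ge | exists n].
exists (u k.+1); have [_ _] := FS k; rewrite F1; apply: QS.
move=> _ [[n _ <-] /= un].
have kn : (k < n)%N.
  by rewrite ltnNge; apply/negP => nk; move: un; rewrite leqNgt uh// ltnS.
by apply: (FD k.+1 (n - k.+1)%N); rewrite subnKC.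
Qed.

(** * Separated functionals *)

Lemma scalar_scale (R : realType) (V : lmodType R) (f : V -> R) t x :
  scalar f -> f (t *: x) = t * f x.
Proof.
move=> fl; have f0 : f 0 = 0.
  by have := fl 1 0 0; rewrite scale1r addr0 => ?; lra.
by rewrite -[t *: x]addr0 fl f0 addr0.
Qed.

Lemma scalar_opp (R : realType) (V : lmodType R) (f : V -> R) x :
  scalar f -> f (- x) = - f x.
Proof. by move=> fl; rewrite -scaleN1r scalar_scale// mulN1r. Qed.

(** The next functional either vanishes on the common kernel so far, or a vector [w] of that kernel
    where it is nonzero joins the family [v]. *)
Lemma finite_codim_kernel (R : realType) (V : lmodType R)
    (f : nat -> V -> R) n :
  (forall i, (i < n)%N -> scalar (f i)) ->
  exists k (v : 'I_k -> V), forall x, exists a : 'I_k -> R,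
    forall i, (i < n)%N -> f i (x - \sum_j a j *: v j) = 0.
Proof.
elim: n => [_|n IH fl]; first by exists 0%N, (fun=> 0) => x; exists (fun=> 0).
have [|k [v Hv]] := IH; first by move=> i /ltnW; apply: fl.
pose ker w := forall i, (i < n)%N -> f i w = 0.
have [[w [kw fw]]|Hw] := pselect (exists w, ker w /\ f n w <> 0); last first.
  exists k, v => x; have [a Ha] := Hv x; exists a => i.
  rewrite ltnS leq_eqVlt => /predU1P[->|]; last exact: Ha.
  by apply: contra_notP Hw => fx; exists (x - \sum_j a j *: v j).
exists k.+1, (fun j => if unlift ord0 j is Some j' then v j' else w) => x.
have [a Ha] := Hv x; set y := x - _ in Ha.
exists (fun j => if unlift ord0 j is Some j' then a j' else f n y / f n w) => i.
rewrite big_ord_recl unlift_none.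
under eq_bigr do rewrite liftK.
rewrite opprD addrCA addrC -/y -[in X in f i X]scaleNr addrC ltnS.
rewrite leq_eqVlt => /predU1P[->|lin]; last first.
  by rewrite (fl i (leqW lin)) (Ha i lin) (kw i lin) mulr0 addr0.
by rewrite (fl n (ltnSn n)) mulNr divfK ?addNr//; apply/eqP.
Qed.

Section Norms.
Variables (R : realType) (V : lmodType R) (p : V -> R).

Record is_norm := IsNorm {
  normD : forall x y, p (x + y) <= p x + p y;
  normZ : forall t x, p (t *: x) = `|t| * p x;
  norm_eq0 : forall x, p x = 0 -> x = 0 }.

Hypothesis pn : is_norm.

Lemma is_norm0 : p 0 = 0.
Proof. by rewrite -(scale0r 0) (normZ pn) normr0 mul0r. Qed.

Lemma is_normN x : p (- x) = p x.
Proof. by rewrite -scaleN1r (normZ pn) normrN1 mul1r. Qed.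

Lemma is_norm_ge0 x : 0 <= p x.
Proof.
have := normD pn x (- x); rewrite subrr is_norm0 is_normN => ?; lra.
Qed.

Lemma is_norm_sublinear : sublinear p.
Proof. by split=> [|t x t0]; [exact: normD | rewrite normZ// gtr0_norm]. Qed.

Lemma unit_norming e : e <> 0 -> exists f : V -> R,
  [/\ scalar f, forall x, `|f x| <= p x & f ((p e)^-1 *: e) = 1].
Proof.
move=> e0; have pe : p e != 0 by apply/eqP => /(norm_eq0 pn).
have [f [fl fp fe]] := norming_functional e is_norm_sublinear.
exists f; split=> // [x|]; last by rewrite scalar_scale// fe mulVf.
by rewrite ler_norml fp lerNl -scalar_opp// -is_normN fp.
Qed.

Hypothesis Vinf : ~ finite_dimensional V.

Lemma kernel_nontrivial (f : nat -> V -> R) n :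
  (forall i, (i < n)%N -> scalar (f i)) ->
  exists e, e <> 0 /\ forall i, (i < n)%N -> f i e = 0.
Proof.
move=> fl; apply: contra_notP Vinf => H.
have [k [v Hv]] := finite_codim_kernel fl.
exists k, v => x; have [a Ha] := Hv x; exists a.
apply/eqP; rewrite -subr_eq0; apply: contra_notT H => /eqP xa.
by exists (x - \sum_j a j *: v j).
Qed.

(** Each functional is normed at a unit vector in the common kernel of its predecessors, nontrivial
    in infinite dimension: there it is 1 and they are 0. *)
Lemma separated_functionals : exists f : nat -> V -> R,
  [/\ forall n, scalar (f n), forall n x, `|f n x| <= p x &
      forall i j, (i < j)%N -> exists x, p x <= 1 /\ f j x - f i x = 1].
Proof.
have step (s : seq (V -> R)) : exists f : V -> R,
    [/\ scalar f, forall x, `|f x| <= p x &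
    (forall i, (i < size s)%N -> scalar (nth (fun=> 0) s i)) ->
    exists x, [/\ p x <= 1, f x = 1 &
      forall i, (i < size s)%N -> nth (fun=> 0) s i x = 0]].
  have [sl|sl] := pselect
    (forall i, (i < size s)%N -> scalar (nth (fun=> 0) s i)); last first.
    exists (fun=> 0); split=> // [t x y|x]; first by rewrite mulr0 addr0.
    by rewrite normr0 is_norm_ge0.
  have [e [e0 se]] := kernel_nontrivial sl.
  have [f [fl fp fe]] := unit_norming e0.
  exists f; split=> // _; exists ((p e)^-1 *: e); split=> // [|i si].
    rewrite (normZ pn) ger0_norm ?invr_ge0 ?is_norm_ge0// mulVf//.
    by apply/eqP => /(norm_eq0 pn).
  by rewrite scalar_scale ?se ?mulr0//; apply: sl.
have [N HN] := choice step.
pose S n := iter n (fun s => rcons s (N s)) [::].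
pose f n := N (S n).
have Sf n : S n = mkseq f n.
  by elim: n => [|n IH]; rewrite ?mkseqS -?IH.
have fl n : scalar (f n) by have [] := HN (S n).
exists f; split=> // [n x|i j ij]; first by have [_ + _] := HN (S n); apply.
have [_ _] := HN (S j); rewrite Sf size_mkseq => Hj.
have [k kj|x [px fx sx]] := Hj; first by rewrite nth_mkseq.
exists x; split=> //.
have := sx i ij; rewrite nth_mkseq// => ->.
by rewrite subr0 /f Sf.
Qed.

End Norms.

(** * The tree of indices *)

Lemma free_unbounded (U : set_system nat) (A : set nat) :
  ProperFilter U -> \oo `<=` U -> U A -> unbounded A.
Proof.
move=> FU oU UA n; have /oU Un : \oo [set m | (n <= m)%N] by exists n.
by have [m [nm Am]] := filter_ex (filterI Un UA); exists m.
Qed.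

Lemma ultrafilter_cvg (R : realType) (U : set_system nat) (u : nat -> R) C :
  UltraFilter U -> (forall m, `|u m| <= C) -> cvg (u @ U).
Proof.
move=> FU uC.
have Uu : UltraFilter (u @ U).
  split=> [|G FG UG]; first exact: fmap_proper_filter.
  apply/seteqP; split=> // A GA.
  have [//|GnA] := in_ultra_setVsetC (u @^-1` A) FU.
  by have [x []] := filter_ex (filterI GA (UG (~` A) GnA)).
have := @segment_compact R (- C) C.
rewrite compact_ultra => /(_ _ Uu)[|l [_ ul]]; last by apply/cvg_ex; exists l.
by apply: nearW => m /=; rewrite in_itv/= -ler_norml.
Qed.

(** One coordinate at a time: its values converge along a free ultrafilter, so they are within [d]
    of the limit infinitely often. *)
Lemma bounded_pigeonhole (R : realType) (u : nat -> nat -> R) C d K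
    (I : set nat) : 0 < d -> (forall m t, (t < K)%N -> `|u m t| <= C) ->
  unbounded I -> exists (l : nat -> R) (J : set nat),
    [/\ J `<=` I, unbounded J &
      forall m t, J m -> (t < K)%N -> `|u m t - l t| <= d].
Proof.
move=> d0; elim: K => [|K IH] uC uI; first by exists (fun=> 0), I; split.
have [|l [J [JI uJ Jl]]] := IH _ uI.
  by move=> m t tK; apply: uC; rewrite leqW.
have [e [eh eJ]] := unbounded_enum uJ.
have [U [FU oU]] := @ultraFilterLemma _ \oo _.
have /cvg_ex[a ua] := @ultrafilter_cvg R U (fun m => u (e m) K) C FU
  (fun m => uC (e m) K (ltnSn K)).
have /cvgrPdist_le /(_ d d0) Ua := ua.
exists (fun t => if t == K then a else l t).
exists (e @` [set m | `|a - u (e m) K| <= d]); split.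
- by move=> _ [m _ <-]; apply: JI.
- move=> n; have [m nm Hm] := free_unbounded _ oU Ua n.
  by exists (e m); [exact: leq_trans nm (increasing_ge eh m) | exists m].
- move=> _ t [m /= Hm <-]; rewrite ltnS leq_eqVlt => /predU1P[->|tK].
    by rewrite eqxx distrC.
  by rewrite ltn_eqF//; apply: Jl.
Qed.

Lemma interleaving_chain K (B : nat -> set nat) b :
  (forall i, (i < K)%N -> unbounded (B i)) ->
  exists s, [/\ size s = K, sorted ltn s, forall i, i \in s -> (b <= i)%N &
    forall i, (i < K)%N -> B i (nth 0%N s i)].
Proof.
elim: K B b => [|K IH] B b uB; first by exists [::]; split.
have [a ba Ba] := uB 0%N isT b.
have [|s [ss so sa sB]] := IH (fun i => B i.+1) a.+1.
  by move=> i iK; apply: uB.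
exists (a :: s); split=> [|/=|i|[|i]//]; first by rewrite /= ss.
- by rewrite (path_sortedE ltn_trans) so andbT; apply/allP => i /sa.
- by rewrite inE => /predU1P[->//|/sa]; apply: leq_trans; rewrite leqW.
- exact: sB.
Qed.

Lemma scalar_sum (R : realType) (V : lmodType R) n (g : nat -> V -> R) :
  (forall i, scalar (g i)) -> scalar (fun x => \sum_(i < n) g i x).
Proof.
move=> gl a x y; rewrite mulr_sumr -big_split /=.
by apply: eq_bigr => i _; rewrite gl.
Qed.

Section NormDetecting.
Variables (R : realType) (V : lmodType R) (p : V -> R).
Hypothesis pn : is_norm p.

(* The failure of the approximate Josefson-Nissenzweig theorem for [eps]. *)
Definition norm_detecting (eps : R) := forall g : nat -> V -> R,
  (forall n, scalar (g n)) ->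
  (forall n, exists C, forall x, `|g n x| <= C * p x) ->
  (forall n, exists x, p x <= 1 /\ 1 <= g n x) ->
  exists x, p x <= 1 /\ unbounded [set n | eps < `|g n x|].

Variables (eps : R) (f : nat -> V -> R).
Hypothesis (eps0 : 0 < eps) (det : norm_detecting eps).
Hypothesis (fl : forall n, scalar (f n)) (fp : forall n x, `|f n x| <= p x).

Lemma norm_detecting_gt (g : nat -> V -> R) c : 0 < c ->
  (forall n, scalar (g n)) ->
  (forall n, exists C, forall x, `|g n x| <= C * p x) ->
  (forall n, exists x, p x <= 1 /\ c <= g n x) ->
  exists x, p x <= 1 /\ unbounded [set n | c * eps < g n x].
Proof.
move=> c0 gl gC gc.
have [n a x y|n|n|x [px ux]] := det (g := fun n x => c^-1 * g n x).
- by rewrite gl; ring.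
- have [C HC] := gC n; exists (c^-1 * C) => x.
  by rewrite normrM gtr0_norm ?invr_gt0// -mulrA ler_pM2l ?invr_gt0.
- have [x [px cx]] := gc n; exists x; split=> //.
  by rewrite mulrC ler_pdivlMr// mul1r.
have /unboundedU[u|u] : unbounded ([set n | c * eps < g n x] `|`
    [set n | c * eps < g n (- x)]).
- apply: unboundedS ux => n /=.
  rewrite normrM gtr0_norm ?invr_gt0// mulrC ltr_pdivlMr// mulrC.
  by rewrite lter_normr scalar_opp// => /orP.
- by exists x.
- by exists (- x); rewrite is_normN.
Qed.

Definition alternating N (s : seq nat) x :=
  \sum_(i < N) (f (nth 0%N s i.*2.+1) x - f (nth 0%N s i.*2) x).

Lemma alternating_scalar N s : scalar (alternating N s).
Proof.
apply: (@scalar_sum _ _ N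
  (fun i x => f (nth 0%N s i.*2.+1) x - f (nth 0%N s i.*2) x)).
by move=> i a x y; rewrite !fl; ring.
Qed.

Lemma alternating_bounded N s x : `|alternating N s x| <= 2 * N%:R * p x.
Proof.
rewrite mulrAC mulr_natr -[X in _ *+ X]card_ord -sumr_const.
apply: le_trans (ler_norm_sum _ _ _) _; apply: ler_sum => i _.
apply: le_trans (ler_normB _ _) _; rewrite mulr2n mulrDl mul1r.
by rewrite lerD.
Qed.

Definition norming N : set (seq nat) :=
  [set s | exists x, p x <= 1 /\ N%:R * eps <= alternating N s x].

Hypothesis fsep :
  forall i j, (i < j)%N -> exists x, p x <= 1 /\ f j x - f i x = 1.

(** The differences of [f] at consecutive pairs of elements of [M] have norm at least 1, so
    detection gives one [x] at which infinitely many exceed [eps]; [N] such pairs in increasing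
    order form the chain. *)
Lemma norming_chain (M : set nat) N : unbounded M ->
  exists s, [/\ sorted ltn s, size s = N.*2, forall i, i \in s -> M i &
    norming N s].
Proof.
move=> /unbounded_enum[u [uh uM]].
have [//|n a x y|n|n|x [px ux]] := @norm_detecting_gt
    (fun n x => f (u n.*2.+1) x - f (u n.*2) x) 1.
- by rewrite !fl; ring.
- exists 2 => x; apply: le_trans (ler_normB _ _) _.
  by rewrite mulr2n mulrDl mul1r lerD.
- have [x [px fx]] := fsep (uh _ _ (ltnSn n.*2)).
  by exists x; rewrite fx.
suff H b : exists s, [/\ sorted ltn s, size s = N.*2,
    forall i, i \in s -> (b <= i)%N /\ M i & N%:R * eps <= alternating N s x].
  have [s [so sz sM sx]] := H 0%N; exists s; split=> // [i /sM[]//|].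
  by exists x.
elim: N b => [|N IH] b.
  by exists [::]; split=> //; rewrite /alternating big_ord0 mul0r.
have [n bn /= nx] := ux b; rewrite mul1r in nx.
have un := uh _ _ (ltnSn n.*2).
have bu : (b <= u n.*2)%N.
  rewrite (leq_trans bn)// (leq_trans _ (increasing_ge uh _))//.
  by rewrite -addnn leq_addr.
have [s [so sz sM sx]] := IH (u n.*2.+1).+1.
exists [:: u n.*2, u n.*2.+1 & s]; split=> [|||].
- rewrite /= un (path_sortedE ltn_trans) so andbT.
  by apply/allP => i /sM[].
- by rewrite /= sz doubleS.
- move=> i; rewrite !inE => /or3P[/eqP->|/eqP->|/sM[ui Mi]]; split=> //.
    by rewrite (leq_trans bu)// ltnW.
  by rewrite (leq_trans bu)// (leq_trans (ltnW un))// ltnW.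
- rewrite /alternating big_ord_recl/= -natr1 mulrDl mul1r addrC.
  by apply: lerD; [exact: ltW | exact: sx].
Qed.

(** Ramsey's theorem for each [k], where [norming_chain] excludes the colour of non-norming tuples,
    followed by diagonalization. *)
Lemma norming_tails : exists M, unbounded M /\ forall k, exists b,
  chains_in (M `&` [set m | (b <= m)%N]) (2 ^ k).*2 (norming (2 ^ k)).
Proof.
apply: (@unbounded_diagonal
  (fun k B => chains_in B (2 ^ k).*2 (norming (2 ^ k)))).
  by move=> k B C; apply: chains_inS.
move=> k A uA.
have [B [BA uB HB]] := ramsey (2 ^ k).*2 (norming (2 ^ k)) uA.
exists B; split=> //; case: HB => // nB.
by have [s [so sz sB]] := norming_chain (2 ^ k) uB; have := nB s so sz sB.
Qed.

Variable M : set nat.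
Hypothesis uM : unbounded M.
Hypothesis normingM : forall k, exists b,
  chains_in (M `&` [set m | (b <= m)%N]) (2 ^ k).*2 (norming (2 ^ k)).

(** Node [t] of level [k.+1] has parent [t./2]. In the mean sibling difference [eps ^+ 2 - 2 * d],
    one [eps] comes from the norm of the alternating sums, one from detection, and [2 * d] from
    replacing values by [l]. *)
Definition splits d k (N N' : nat -> set nat) x (l : nat -> R) :=
  [/\ p x <= 1,
      forall t, (t < (2 ^ k).*2)%N -> N' t `<=` N t./2,
      forall t i, (t < (2 ^ k).*2)%N -> N' t i -> `|f i x - l t| <= d &
      (2 ^ k)%:R * (eps ^+ 2 - 2 * d) <=
        \sum_(i < 2 ^ k) (l i.*2.+1 - l i.*2)].

(* The tuples are chosen with increasing entries, the two indices for a node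
   being adjacent, so that the hypothesis on alternating sums applies although
   the sets [N t] are unrelated. *)
Lemma tree_step d k (N : nat -> set nat) : 0 < d ->
  (forall t, (t < 2 ^ k)%N -> N t `<=` M /\ unbounded (N t)) ->
  exists N' x l,
    splits d k N N' x l /\ forall t, (t < (2 ^ k).*2)%N -> unbounded (N' t).
Proof.
move=> d0 HN; have [b Hb] := normingM k.
have HN2 t : (t < (2 ^ k).*2)%N -> (t./2 < 2 ^ k)%N by rewrite -ltn_double; lia.
(* Entries beyond [b] make the tuple norming; entries beyond [m] make the new nodes infinite. *)
have /choice[s Hs] m : exists s, [/\ size s = (2 ^ k).*2, sorted ltn s,
    forall i, i \in s -> (maxn b m <= i)%N &
    forall t, (t < (2 ^ k).*2)%N -> N t./2 (nth 0%N s t)].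
  apply: (@interleaving_chain _ (fun t => N t./2)) => t /HN2 tk.
  by have [] := HN _ tk.
have normings m : norming (2 ^ k) (s m).
  have [sz so sb sN] := Hs m; apply: Hb => // i si.
  have := sb i si; rewrite geq_max => /andP[bi _]; split=> //.
  have [t ts <-] := nthP 0%N si; rewrite sz in ts.
  have [+ _] := HN _ (HN2 _ ts); apply; exact: sN.
have k0 : (0 : R) < (2 ^ k)%:R by rewrite ltr0n expn_gt0.
(* At a single [x], infinitely many of the alternating sums exceed [2 ^ k * eps * eps]; the
   pigeonhole then stabilizes all their terms. *)
have [||m|m|x [px ux]] := @norm_detecting_gt
  (fun m x => alternating (2 ^ k) (s m) x) ((2 ^ k)%:R * eps).
- by rewrite mulr_gt0.
- by move=> m; apply: alternating_scalar.
- by exists (2 * (2 ^ k)%:R) => x; apply: alternating_bounded.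
- exact: normings.
have [|l [J [JI uJ Jl]]] := @bounded_pigeonhole R
    (fun m t => f (nth 0%N (s m) t) x) (p x) d (2 ^ k).*2 _ d0 _ ux.
  by move=> m t _.
exists (fun t => [set nth 0%N (s m) t | m in J]), x, l; split; last first.
  move=> t tk n; have [m nm Jm] := uJ n.
  exists (nth 0%N (s m) t); last by exists m.
  have [sz so sb sN] := Hs m.
  by rewrite (leq_trans nm)// (leq_trans (leq_maxr b m))// sb// mem_nth// sz.
split=> //.
- by move=> t tk _ [m _ <-]; have [_ _ _] := Hs m; apply.
- by move=> t _ tk [m Jm <-]; apply: Jl.
have [m _ Jm] := uJ 0%N; have /ltW := JI _ Jm; rewrite /alternating => Hm.
rewrite mulrBr -mulrA -expr2 in Hm *.
rewrite lerBlDr (le_trans Hm)// [X in _ + X]mulrC mulr_natr.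
rewrite -[X in _ *+ X]card_ord -sumr_const -big_split/=; apply: ler_sum => i _.
have := Jl m i.*2 Jm; have := Jl m i.*2.+1 Jm.
rewrite !ltn_double ltn_Sdouble ltn_ord => /(_ isT) + /(_ isT).
rewrite !ler_norml => /andP[? ?] /andP[? ?]; lra.
Qed.

End NormDetecting.

(** * Rademacher averages *)

Lemma sum_double (R : nmodType) n (g : nat -> R) :
  \sum_(i < n.*2) g i = \sum_(i < n) (g i.*2 + g i.*2.+1).
Proof.
elim: n => [|n IH]; first by rewrite !big_ord0.
by rewrite doubleS !big_ord_recr/= IH addrA.
Qed.

Lemma ler_sum_prefix (R : numDomainType) n m (g : nat -> R) : (n <= m)%N ->
  (forall k, 0 <= g k) -> \sum_(k < n) g k <= \sum_(k < m) g k.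
Proof.
move=> nm g0; rewrite -!(big_mkord xpredT g) [leRHS](big_cat_nat _ nm)//=.
by rewrite lerDl sumr_ge0.
Qed.

Lemma sqr_sum_le (R : realDomainType) n (c : 'I_n -> R) :
  (\sum_i c i) ^+ 2 <= n%:R * \sum_i c i ^+ 2.
Proof.
case: n c => [|n] c; first by rewrite !big_ord0 mul0r expr0n.
set S := \sum_i c i; set Q := \sum_i c i ^+ 2; set m : R := n.+1%:R.
have : 0 <= \sum_i (m * c i - S) ^+ 2 by apply: sumr_ge0 => i _; apply: sqr_ge0.
have -> : \sum_i (m * c i - S) ^+ 2 = m * (m * Q - S ^+ 2).
  transitivity (\sum_i (m ^+ 2 * c i ^+ 2 + (- (2 * m * S) * c i + S ^+ 2))).
    by apply: eq_bigr => i _; ring.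
  rewrite !big_split/= sumr_const card_ord -!mulr_sumr -/S -/Q.
  by rewrite -[S ^+ 2 *+ _]mulr_natl -/m; ring.
by rewrite pmulr_rge0 ?ltr0Sn// subr_ge0.
Qed.

Section Rademacher.
Variable R : realFieldType.
Implicit Types (y : nat -> R) (d l a : nat).

(* The leaf values [y] are averaged over the [2 ^ d] leaves below the node [a]
   of the binary tree in which [a] has children [2 a] and [2 a + 1]. *)
Fixpoint descendant_mean d y a : R :=
  if d is d'.+1 then
    (descendant_mean d' y a.*2 + descendant_mean d' y a.*2.+1) / 2
  else y a.

(* The normalized inner product of the leaf values, at depth [l.+1 + d], with
   the [l]-th Rademacher function. *)
Definition rademacher d l y : R := (2 ^ l.+1)%:R^-1 *
  \sum_(a < 2 ^ l) (descendant_mean d y a.*2.+1 - descendant_mean d y a.*2).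

Let energy d l y : R :=
  (2 ^ l)%:R^-1 * \sum_(a < 2 ^ l) descendant_mean d y a ^+ 2.

(** By the parallelogram identity, the mean square of the children's averages is that of the
    parents' plus that of the half-differences. By Cauchy-Schwarz the latter dominates the square of
    the mean half-difference, which is [rademacher d l y]. *)
Lemma energy_step d l y :
  energy d.+1 l y + rademacher d l y ^+ 2 <= energy d l.+1 y.
Proof.
set z := descendant_mean d y; pose c a := (z a.*2.+1 - z a.*2) / 2.
have k0 : (0 : R) < (2 ^ l)%:R by rewrite ltr0n expn_gt0.
have rE : rademacher d l y = (2 ^ l)%:R^-1 * \sum_(a < 2 ^ l) c a.
  by rewrite /rademacher /c -mulr_suml expnS natrM invfM -/z; ring.
have r2 : rademacher d l y ^+ 2 <= (2 ^ l)%:R^-1 * \sum_(a < 2 ^ l) c a ^+ 2.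
  rewrite rE exprMn expr2 -mulrA ler_pM2l ?invr_gt0// ler_pdivrMl//.
  exact: sqr_sum_le.
apply: le_trans (lerD (lexx _) r2) _; rewrite /energy -mulrDr -big_split/=.
rewrite expnS mul2n (sum_double _ (fun t => z t ^+ 2)) -mul2n.
rewrite natrM invfM -mulrA mulrCA.
rewrite ler_pM2l ?invr_gt0// mulr_sumr le_eqVlt; apply/predU1P; left.
by apply: eq_bigr => a _; rewrite -/z /c; field.
Qed.

(** [energy_step] telescopes from the root to the leaves, where the energy is the mean square of the
    values [y]. *)
Lemma rademacher_bessel m y P : (forall t, (t < 2 ^ m)%N -> `|y t| <= P) ->
  \sum_(l < m) rademacher (m - l.+1) l y ^+ 2 <= P ^+ 2.
Proof.
move=> yP; have P0 : 0 <= P by apply: le_trans (yP 0%N _); rewrite ?expn_gt0.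
have yE : energy 0 m y <= P ^+ 2.
  rewrite /energy ler_pdivrMl ?ltr0n ?expn_gt0// mulr_natl.
  rewrite -[X in _ *+ X]card_ord -sumr_const; apply: ler_sum => t _ /=.
  by rewrite -real_normK ?num_real// lerXn2r ?nnegrE// yP.
apply: le_trans yE.
suff H k : (k <= m)%N ->
    \sum_(l < k) rademacher (m - l.+1) l y ^+ 2 <= energy (m - k) k y.
  by have := H m (leqnn m); rewrite subnn.
elim: k => [_|k IH km].
  rewrite big_ord0 mulr_ge0 ?invr_ge0 ?ler0n//.
  by apply: sumr_ge0 => a _; apply: sqr_ge0.
rewrite big_ord_recr/=; apply: le_trans (energy_step _ _ _); rewrite lerD2r.
by rewrite -subSn// subSS; apply: IH; apply: ltnW.
Qed.

Lemma rademacher_ge d l y (z : nat -> R) e c :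
  (forall a, (a < (2 ^ l).*2)%N -> `|descendant_mean d y a - z a| <= e) ->
  (2 ^ l)%:R * c <= \sum_(a < 2 ^ l) (z a.*2.+1 - z a.*2) ->
  (c - 2 * e) / 2 <= rademacher d l y.
Proof.
move=> yz zc; rewrite /rademacher expnS natrM invfM -mulrA mulrC.
have k0 : (0 : R) < (2 ^ l)%:R by rewrite ltr0n expn_gt0.
rewrite ler_pM2l ?invr_gt0// ler_pdivlMl// mulrBr.
rewrite lerBlDr (le_trans zc)// [(2 ^ l)%:R * _]mulr_natl.
rewrite -[X in (2 * e) *+ X]card_ord -sumr_const -big_split.
apply: ler_sum => a _ /=.
have := yz a.*2; have := yz a.*2.+1.
rewrite ltn_double ltn_Sdouble ltn_ord => /(_ isT) + /(_ isT).
rewrite !ler_norml => /andP[? ?] /andP[? ?]; lra.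
Qed.

End Rademacher.

Section RademacherScalar.
Variables (R : realType) (V : lmodType R) (g : nat -> V -> R).
Hypothesis gl : forall i, scalar (g i).

Lemma descendant_mean_scalar d a :
  scalar (fun x => descendant_mean d (g^~ x) a).
Proof.
elim: d a => [|d IH] a t x y /=; first exact: gl.
by rewrite !IH; ring.
Qed.

Lemma rademacher_scalar d l : scalar (fun x => rademacher d l (g^~ x)).
Proof.
move=> t x y; rewrite /rademacher.
have := @scalar_sum _ _ (2 ^ l) (fun a x => descendant_mean d (g^~ x) a.*2.+1
  - descendant_mean d (g^~ x) a.*2) _ t x y.
rewrite /= => ->; first by ring.
by move=> a {}t {}x {}y; rewrite !descendant_mean_scalar; ring.
Qed.

End RademacherScalar.

(** * Limit functionals along the tree and the contradiction with Bessel's inequality *)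

Section Contradiction.
Variables (R : realType) (V : lmodType R) (p : V -> R).
Hypothesis (pn : is_norm p) (Vinf : ~ finite_dimensional V).

Lemma not_norm_detecting (eps : R) : 0 < eps -> ~ norm_detecting p eps.
Proof.
move=> eps0 det.
have [f [fl fp fsep]] := separated_functionals pn Vinf.
have [M [uM HM]] := norming_tails pn det fl fp fsep.
(* With this [d], [rademacher_ge] yields [(eps ^+ 2 - 2 * d - 2 * d) / 2 = eps ^+ 2 / 4]. *)
pose d := eps ^+ 2 / 8; have d0 : 0 < d by rewrite divr_gt0// exprn_gt0.
pose P (z : nat * (nat -> set nat)) :=
  forall t, (t < 2 ^ z.1)%N -> z.2 t `<=` M /\ unbounded (z.2 t).
pose S := {z | P z}.
have step (z : S) : {w : S | (sval w).1 = (sval z).1.+1 /\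
    exists x l, splits p eps f d (sval z).1 (sval z).2 (sval w).2 x l}.
  apply: cid; case: z => -[k N] /= HN.
  have [N' [x [l [spl uN']]]] := tree_step pn eps0 det fl fp HM d0 HN.
  have HN' t : (t < 2 ^ k.+1)%N -> N' t `<=` M /\ unbounded (N' t).
    rewrite expnS mul2n => tk; split; last exact: uN'.
    have [_ sN _ _] := spl; apply: subset_trans (sN t tk) _.
    have t2 : (t./2 < 2 ^ k)%N by rewrite -ltn_double; lia.
    by have [] := HN _ t2.
  by exists (exist P (k.+1, N') HN'); split=> //; exists x, l.
have root t : (t < 2 ^ 0)%N -> M `<=` M /\ unbounded M by split.
have [F [F0 FS]] := dependent_choice step (exist P (0%N, fun=> M) root).
have F1 n : (sval (F n)).1 = n.
  by elim: n => [|n IH]; [rewrite F0 | have [-> _] := FS n; rewrite IH].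
pose N k := (sval (F k)).2.
have uN k t : (t < 2 ^ k)%N -> unbounded (N k t).
  by move=> tk; have [] := svalP (F k) t; rewrite ?F1.
have /choice[x_ /choice[l_ spl]] k :
    exists x l, splits p eps f d k (N k) (N k.+1) x l.
  by have [_] := FS k; rewrite F1.
(* One index from each node of level [m]: the leaves of the tree cut at depth [m]. *)
have /choice[s Hs] m : exists s : nat -> nat,
    forall t, (t < 2 ^ m)%N -> N m t (s t).
  have /choice[s Hs] t : exists i, (t < 2 ^ m)%N -> N m t i.
    have [tm|_] := ltnP t (2 ^ m); last by exists 0%N.
    by have [i _ Ni] := uN m t tm 0%N; exists i.
  by exists s.
(* All leaves below a node belong to its index set, so averaging them stays within [d] of [c]. *)
have mean_close m e l x z c : (m + e = l)%N -> (z < 2 ^ m)%N ->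
    (forall i, N m z i -> `|f i x - c| <= d) ->
    `|descendant_mean e (fun t => f (s l t) x) z - c| <= d.
  elim: e m z => [|e IH] m z; first by rewrite addn0 => <- zm; apply; apply: Hs.
  rewrite addnS -addSn => ml zm Nd /=.
  have child t : (t < (2 ^ m).*2)%N -> t./2 = z ->
      `|descendant_mean e (fun t => f (s l t) x) t - c| <= d.
    move=> tm tz; apply: (IH m.+1) => // [|i Ni].
      by rewrite expnS mul2n.
    by apply: Nd; rewrite -tz; have [_ + _ _] := spl m; apply.
  have := child z.*2; rewrite ltn_double zm doubleK => /(_ isT erefl).
  have := child z.*2.+1.
  rewrite ltn_Sdouble zm /= uphalf_double => /(_ isT erefl).
  rewrite !ler_norml => /andP[? ?] /andP[? ?]; lra.
(* The default 0 for [k >= m] does not affect the limit in [m]. *)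
pose H m k x := if (k < m)%N then
  rademacher (m - k.+1) k (fun t => f (s m t) x) else 0.
have Hl m k : scalar (H m k).
  rewrite /H => a x y; case: ifP => _; last by rewrite mulr0 addr0.
  exact: (@rademacher_scalar _ _ (fun t x => f (s m t) x)).
have Hbessel m n x : (n <= m)%N -> \sum_(k < n) H m k x ^+ 2 <= p x ^+ 2.
  move=> nm; apply: le_trans (ler_sum_prefix nm (fun k => sqr_ge0 (H m k x))) _.
  apply: le_trans _ (@rademacher_bessel _ m (fun t => f (s m t) x) (p x)
    (fun t _ => fp _ _)).
  rewrite le_eqVlt; apply/predU1P; left; apply: eq_bigr => k _.
  by rewrite /H ltn_ord.
have Hp m k x : `|H m k x| <= p x.
  have [km|mk] := ltnP k m; last first.
    by rewrite /H ltnNge mk normr0 is_norm_ge0.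
  rewrite -(ler_pXn2r (n := 2))// ?nnegrE ?is_norm_ge0// real_normK ?num_real//.
  apply: le_trans (Hbessel m k.+1 x km); rewrite big_ord_recr/= lerDr.
  by apply: sumr_ge0 => i _; apply: sqr_ge0.
have Hx m k : (k < m)%N -> eps ^+ 2 / 4 <= H m k (x_ k).
  move=> km; rewrite /H km; have [_ _ lN lc] := spl k.
  have /(_ _ _ lc) := @rademacher_ge _ (m - k.+1) k
    (fun t => f (s m t) (x_ k)) (l_ k) d.
  rewrite /d => hr; apply: le_trans (hr _); first by lra.
  move=> a ak; apply: (mean_close k.+1) => //; first by rewrite subnKC.
  - by rewrite expnS mul2n.
  - by move=> i; apply: lN.
have [U [FU oU]] := @ultraFilterLemma _ \oo _.
have cvgH k x : cvg (H m k x @[m --> U]).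
  exact: (@ultrafilter_cvg R U (fun m => H m k x) (p x) FU (fun m => Hp m k x)).
pose L k x := lim (H m k x @[m --> U]).
have Ll k : scalar (L k).
  move=> a x y; apply/cvg_lim => //.
  under eq_fun do rewrite Hl.
  by apply: cvgD; [apply: cvgMl_tmp|]; apply: cvgH.
(* Detection is applied to [L] itself: at some [x] infinitely many [L k x] exceed a fixed positive
   constant, so the partial sums of their squares are unbounded. *)
have [||k|k|x [px ux]] := norm_detecting_gt pn det (g := L) (c := eps ^+ 2 / 4).
- by rewrite divr_gt0// exprn_gt0.
- exact: Ll.
- exists 1 => x; rewrite mul1r ler_norml; apply/andP; split.
  + apply: limr_ge => //; apply: nearW => m.
    by have := Hp m k x; rewrite ler_norml => /andP[].
  + apply: limr_le => //; apply: nearW => m.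
    by have := Hp m k x; rewrite ler_norml => /andP[].
- exists (x_ k); split; first by have [] := spl k.
  apply: limr_ge => //; apply: oU; exists k.+1 => // m; exact: Hx.
have Lbessel n : \sum_(k < n) L k x ^+ 2 <= 1.
  have cvgS : \sum_(k < n) H m k x ^+ 2 @[m --> U] --> \sum_(k < n) L k x ^+ 2.
    elim: n => [|n IH].
      under eq_fun do rewrite big_ord0.
      by rewrite big_ord0; apply: cvg_cst.
    under eq_fun do rewrite big_ord_recr.
    rewrite big_ord_recr /=; apply: cvgD => //.
    by rewrite expr2; apply: cvgM; apply: cvgH.
  rewrite -(cvg_lim _ cvgS)//; apply: limr_le.
    by apply/cvg_ex; eexists; exact: cvgS.
  apply: oU; exists n => // m /= nm; apply: le_trans (Hbessel m n x nm) _.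
  by rewrite expr_le1// is_norm_ge0.
pose c := eps ^+ 2 / 4 * eps.
have c0 : 0 < c by rewrite mulr_gt0// divr_gt0// exprn_gt0.
have Lunbounded j : exists n, j%:R * c ^+ 2 <= \sum_(k < n) L k x ^+ 2.
  elim: j => [|j [n Hn]]; first by exists 0%N; rewrite big_ord0 mul0r.
  have [k nk /= Lk] := ux n; exists k.+1.
  rewrite big_ord_recr/= -natr1 mulrDl mul1r lerD//.
    exact: le_trans Hn (ler_sum_prefix nk (fun k => sqr_ge0 (L k x))).
  by rewrite lerXn2r ?nnegrE ?ltW// (lt_trans c0).
have [n] := Lunbounded (Num.bound (c ^+ 2)^-1).
apply/negP; rewrite -ltNge; apply: le_lt_trans (Lbessel n) _.
rewrite -ltr_pdivrMr ?exprn_gt0// mul1r; apply: archi_boundP.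
by rewrite invr_ge0 exprn_ge0// ltW.
Qed.

End Contradiction.

(** * Weakly small functionals *)

(** By homogeneity, a nonzero [x] violating the last clause would, once normalized, be a point of
    detection for [g]. *)
Lemma weak_josefson_nissenzweig (R : realType) (V : lmodType R) (p : V -> R)
    (eps : R) : is_norm p -> ~ finite_dimensional V -> 0 < eps ->
  exists g : nat -> V -> R,
    [/\ forall n, scalar (g n),
        forall n, exists C, forall x, `|g n x| <= C * p x,
        forall n, exists x, p x <= 1 /\ 1 <= g n x &
        forall x, exists b, forall n, (b <= n)%N -> `|g n x| <= eps * p x].
Proof.
move=> pn Vinf eps0; apply: contra_notP (not_norm_detecting pn Vinf eps0).
move=> H g gl gC g1; apply: contra_notP H => Hg; exists g; split=> // x.
have [->|x0] := eqVneq x 0.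
  exists 0%N => n _; rewrite -{1}(scale0r 0) scalar_scale// mul0r normr0.
  by rewrite mulr_ge0 ?(ltW eps0) ?is_norm_ge0.
have px : 0 < p x.
  rewrite lt_neqAle is_norm_ge0// andbT eq_sym.
  by apply: contra_neq x0; apply: norm_eq0.
have pvx : p ((p x)^-1 *: x) <= 1.
  by rewrite normZ// gtr0_norm ?invr_gt0// mulVf// gt_eqF.
have /existsNP[b Hb] : ~ unbounded [set n | eps < `|g n ((p x)^-1 *: x)|].
  by move=> u; apply: Hg; exists ((p x)^-1 *: x).
exists b => n bn; rewrite leNgt; apply/negP => gx; apply: Hb; exists n => //=.
by rewrite scalar_scale// normrM gtr0_norm ?invr_gt0// mulrC ltr_pdivlMr.
Qed.

(** The pointwise bound is independent of [k]; its factor 2 leaves room for the real and imaginary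
    parts of complex functionals. *)
Definition has_weakly_small_functionals (K : numFieldType)
    (X : normedModType K) := forall k : nat,
  exists f : nat -> {linear X -> K^o},
    [/\ forall n, continuous (f n),
        forall n, exists x, `|x| <= 1 /\ k%:R <= `|f n x| &
        forall x, exists b, forall n, (b <= n)%N -> `|f n x| <= 2 * `|x|].

Lemma bounded_functional_continuous (K : numFieldType) (X : normedModType K)
    (f : {linear X -> K^o}) (C : K) :
  0 <= C -> (forall x, `|f x| <= C * `|x|) -> continuous f.
Proof.
move=> C0 fC; apply/linear_bounded_continuous/linear_boundedP.
near=> r => x; apply: le_trans (fC x) _; apply: ler_wpM2r => //.
by near: r; apply: nbhs_pinfty_ge; rewrite ger0_real.
Unshelve. all: by end_near. Qed.

(** Functionals for [eps = 1 / (k + 1)] are multiplied by [k + 1]. *)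
Lemma real_has_weakly_small_functionals (R : realType) (X : normedModType R) :
  ~ finite_dimensional X -> has_weakly_small_functionals X.
Proof.
move=> Xinf k.
have pn : is_norm (fun x : X => `|x|).
  split=> [x y|t x|x]; first exact: ler_normD.
    exact: normrZ.
  exact: normr0_eq0.
have k0 : 0 < k.+1%:R^-1 :> R by rewrite invr_gt0.
have [g [gl gC g1 gx]] := weak_josefson_nissenzweig pn Xinf k0.
have hl n : linear (fun x => k.+1%:R * g n x : R^o).
  by move=> a x y; rewrite gl mulrDr mulrCA.
pose f n : {linear X -> R^o} := HB.pack (fun x => k.+1%:R * g n x : R^o)
  (GRing.isLinear.Build _ _ _ _ _ (hl n)).
exists f; split=> [n|n|x].
- have [C HC] := gC n.
  apply: (@bounded_functional_continuous _ _ _ (k.+1%:R * `|C|)) => [|x].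
    by rewrite mulr_ge0.
  rewrite /f /= normrM ger0_norm// -mulrA ler_wpM2l//.
  by apply: le_trans (HC x) _; rewrite ler_wpM2r// ler_norm.
- have [x [px gnx]] := g1 n; exists x; split=> //.
  apply: le_trans (ler_norm _); rewrite /f /=.
  rewrite -[leLHS]mulr1; apply: ler_pM => //; by rewrite ler_nat.
- have [b Hb] := gx x; exists b => n /Hb.
  rewrite /f /= normrM ger0_norm// ler_pdivlMl// => /le_trans; apply.
  by rewrite ler_peMl// ler1n.
Qed.

(** * The complex case, by restricting to real scalars on a copy of the space *)

Definition realification (R : realType) (X : lmodType R[i]) : Type := X.

HB.instance Definition _ (R : realType) (X : lmodType R[i]) :=
  GRing.Zmodule.copy (realification X) X.

Section Realification.
Variables (R : realType) (X : lmodType R[i]).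
Local Open Scope complex_scope.

Let scale (a : R) (x : realification X) : realification X := a%:C *: (x : X).

Let scaleA a b x : scale a (scale b x) = scale (a * b) x.
Proof. by rewrite /scale scalerA rmorphM. Qed.

Let scale1 : left_id 1 scale.
Proof. by move=> x; apply: scale1r. Qed.

Let scaleDr : right_distributive scale +%R.
Proof. by move=> a x y; apply: scalerDr. Qed.

Let scaleDl x : {morph scale^~ x : a b / a + b}.
Proof. by move=> a b; rewrite /scale rmorphD scalerDl. Qed.

HB.instance Definition _ := GRing.Zmodule_isLmodule.Build R (realification X)
  scaleA scale1 scaleDr scaleDl.

Lemma realification_scaleE (a : R) (x : realification X) :
  a *: x = a%:C *: (x : X) :> X.
Proof. by []. Qed.

Lemma realification_infinite_dimensional :
  ~ finite_dimensional X -> ~ finite_dimensional (realification X).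
Proof.
apply: contra_not => -[n [v Hv]]; exists n, v => x.
by have [a ->] := Hv x; exists (fun i => (a i)%:C).
Qed.

End Realification.

Section ComplexFunctionals.
Variables (R : realType) (X : normedModType R[i]).
Local Open Scope complex_scope.

Lemma normc_real (a : R) : `|a%:C| = `|a|%:C.
Proof. by rewrite normc_def /= expr0n addr0 sqrtr_sqr. Qed.

Lemma normc_le_ReIm (a b : R) : `|a +i* b| <= (`|a| + `|b|)%:C.
Proof.
have -> : a +i* b = a%:C + 'i * b%:C by exact: complexE.
apply: le_trans (ler_normD _ _) _; rewrite normrM !normc_real rmorphD lerD2l.
by rewrite normc_def /= expr0n expr1n add0r sqrtr1 mul1r.
Qed.

Definition realification_norm (x : realification X) : R :=
  complex.Re `|x : X|.

Lemma realification_normE (x : X) : `|x| = (realification_norm x)%:C.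
Proof. by rewrite RRe_real// ger0_real. Qed.

Lemma realification_is_norm : is_norm realification_norm.
Proof.
split=> [x y|t x|x x0].
- rewrite -lecR rmorphD /= -!realification_normE.
  exact: (@ler_normD _ X).
- apply: complexI; rewrite rmorphM /= -!realification_normE.
  by rewrite realification_scaleE normrZ normc_real.
- by apply: (@normr0_eq0 _ X); rewrite realification_normE x0.
Qed.

(** For real-linear [g], the unique complex-linear functional with real part [g]. *)
Definition complexify (g : realification X -> R) (x : X) : R[i] :=
  g x +i* (- g ('i *: x)).

Lemma complexify_linear g : scalar g -> linear (complexify g : X -> R[i]^o).
Proof.
move=> gl a x y.
rewrite {1}/complexify.
have aE : a = (complex.Re a)%:C + 'i * (complex.Im a)%:C := complexE a.
have gE (u v : R) (z w : X) :
    g (u%:C *: z + (v%:C *: ('i *: z) + w)) = u * g z + (v * g ('i *: z) + g w).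
  by rewrite (gl u z) (gl v).
have e1 : a *: x + y =
    (complex.Re a)%:C *: x + ((complex.Im a)%:C *: ('i *: x) + y).
  by rewrite {1}aE scalerDl scalerA [_ * 'i]mulrC addrA.
have e2 : 'i *: (a *: x + y) = (- complex.Im a)%:C *: x +
    ((complex.Re a)%:C *: ('i *: x) + 'i *: y).
  rewrite e1 !scalerDr !scalerA addrA [X in X + _ = _]addrC -addrA.
  congr (_ *: _ + (_ *: _ + _)); last by rewrite mulrC.
  by rewrite mulrAC -expr2 sqr_i mulN1r rmorphN.
have e3 : (- complex.Im a)%:C *: x + ((complex.Re a)%:C *: ('i *: x) + 'i *: y)
  = (complex.Re a)%:C *: ('i *: x) + ((- complex.Im a)%:C *: x + 'i *: y).
  by rewrite addrCA.
rewrite e2 e1 gE e3 (gl (complex.Re a) ('i *: x)) (gl (- complex.Im a) x).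
case: a {aE e1 e2 e3} => u v /=.
by apply/eqP; rewrite eq_complex/=; apply/andP; split; apply/eqP; ring.
Qed.

(** The real part gives the lower bound on the norm; the upper bounds combine those of [g n] at [x]
    and at ['i *: x], which have equal norms. *)
Lemma complex_has_weakly_small_functionals :
  ~ finite_dimensional X -> has_weakly_small_functionals X.
Proof.
move=> /realification_infinite_dimensional Xinf k.
have pn := realification_is_norm.
have k0 : 0 < k.+1%:R^-1 :> R by rewrite invr_gt0.
have [g [gl gC g1 gx]] := weak_josefson_nissenzweig pn Xinf k0.
have hl n : linear (fun x => k.+1%:R * complexify (g n) x : R[i]^o).
  move=> a x y; rewrite (complexify_linear (gl n) a x y) mulrDr.
  by rewrite -[a *: _]/(a * _) mulrCA.
pose f n : {linear X -> R[i]^o} :=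
  HB.pack (fun x => k.+1%:R * complexify (g n) x : R[i]^o)
  (GRing.isLinear.Build _ _ _ _ _ (hl n)).
have normiX (x : X) : realification_norm ('i *: x) = realification_norm x.
  apply: complexI; rewrite -!realification_normE normrZ.
  by rewrite [`|'i|]normc_def /= expr0n expr1n add0r sqrtr1 mul1r.
have fle n (x : X) B : `|g n x| <= B -> `|g n ('i *: x)| <= B ->
    `|f n x| <= (k.+1%:R * (2 * B))%:C.
  move=> gB giB; rewrite /f /= normrM ger0_norm// rmorphM rmorph_nat.
  rewrite ler_wpM2l//; apply: le_trans (normc_le_ReIm _ _) _.
  by rewrite lecR normrN mulr2n mulrDl mul1r lerD.
exists f; split=> [n|n|x].
- have [C HC] := gC n.
  apply: (@bounded_functional_continuous _ _ _ (k.+1%:R * (2 * `|C|))%:C)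
    => [|x].
    by rewrite -(rmorph0 (real_complex R)) lecR !mulr_ge0.
  rewrite realification_normE -rmorphM -mulrA -mulrA; apply: fle.
    by apply: le_trans (HC _) _; rewrite ler_wpM2r ?(is_norm_ge0 pn)// ler_norm.
  apply: le_trans (HC _) _; rewrite normiX.
  by rewrite ler_wpM2r ?(is_norm_ge0 pn)// ler_norm.
- have [x [px gnx]] := g1 n; exists x; split.
    by rewrite realification_normE -(rmorph1 (real_complex R)) lecR.
  rewrite /f /= normrM ger0_norm// -[leLHS]mulr1; apply: ler_pM => //.
    by rewrite ler_nat.
  apply: le_trans (normc_ge_Re _); rewrite -(rmorph1 (real_complex R)) lecR /=.
  exact: le_trans gnx (ler_norm _).
- have [b1 Hb1] := gx x; have [b2 Hb2] := gx ('i *: x : X).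
  exists (maxn b1 b2) => n; rewrite geq_max => /andP[/Hb1 + /Hb2].
  rewrite normiX => h1 h2; apply: le_trans (fle _ _ _ h1 h2) _.
  rewrite realification_normE -(rmorph_nat (real_complex R)) -rmorphM lecR.
  by rewrite mulrCA mulVKf.
Qed.

End ComplexFunctionals.

(** * The operators *)

Section Operators.
Variables (K : numFieldType) (X : normedModType K) (F : set_system nat).
Hypothesis FF : ProperFilter F.
Hypothesis archi : forall r : K, 0 < r -> exists k : nat, 1 < k%:R * r.
Hypothesis Xsmall : has_weakly_small_functionals X.

Lemma stationaryS (A B : set nat) :
  A `<=` B -> stationary F A -> stationary F B.
Proof. by move=> AB; apply: contra_not; apply: filterS; apply: subsetC. Qed.

Lemma stationaryI (A B : set nat) :
  stationary F A -> F B -> stationary F (A `&` B).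
Proof.
move=> sA FB; apply: contra_not sA => FAB.
by apply: filterS (filterI FAB FB) => i [nAB Bi] Ai; apply: nAB.
Qed.

(** [T i] comes from the [k]-th sequence when [i] is in the layer of [A k] without [A k.+1]. The
    indices of large values at [x] are almost contained in every [A k], hence not stationary, which
    gives pointwise boundedness. *)
Lemma unbounded_operators (A : nat -> set nat) : decreasing_sets A ->
  (forall B, B `<=` A 0%N -> (forall k, almost_subset B (A k)) ->
    ~ stationary F B) ->
  exists T : nat -> {linear X -> K^o},
    [/\ forall i, continuous (T i), pointwise_filter_bounded F T &
        exists2 V : set K^o, nbhs (0 : K^o) V &
        forall U, nbhs (0 : X) U -> exists k, forall i, A k i ->
          T i @` U `<=` V -> forall j, A j i].
Proof.
move=> Adec HA.
have Amono m n : (m <= n)%N -> A n `<=` A m.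
  by move=> /subnKC <-; elim: (n - m)%N => [|d IH]; rewrite ?addn0// addnS;
    apply: subset_trans IH.
have [f Hf] := choice Xsmall.
(* [None] marks the indices outside [A 0] and those lying in every [A j]. *)
have /choice[lev Hlev] i : exists l : option nat, if l is Some k
    then A k i /\ ~ A k.+1 i else A 0%N i -> forall j, A j i.
  have [[A0 /existsNP[j nAj]]|nA] :=
      pselect (A 0%N i /\ ~ forall j, A j i); last first.
    by exists None => A0; apply: contrapT => nAj; apply: nA.
  elim: j nAj => [//|j IH nAj].
  by have [Aj|/IH//] := pselect (A j i); exists (Some j).
pose T i : {linear X -> K^o} :=
  if lev i is Some k then f k i else (\0 : {linear X -> K^o}).
exists T; split.
- move=> i; rewrite /T; case: (lev i) => [k|]; first by have [] := Hf k.
  by apply: cst_continuous.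
- move=> x V /nbhs_normP[e /= e0 eV].
  pose E := [set i | ~ (`|T i x| <= 2 * `|x|)].
  have oE i : E i -> exists k, lev i = Some k.
    rewrite /E /T /=; case: (lev i) => [k _|]; first by exists k.
    by case; rewrite normr0 mulr_ge0.
  have /choice[b Hb] k : exists b,
      forall n, (b <= n)%N -> `|f k n x| <= 2 * `|x|.
    by have [_ _] := Hf k; apply.
  have : ~ stationary F E.
    apply: HA => [i Ei|j].
      have [k oi] := oE i Ei; have := Hlev i; rewrite oi => -[Aki _].
      exact: Amono Aki.
    (* Outside [A j] only the layers [k < j] occur, and in layer [k] large values stop before
       [b k]. *)
    apply: sub_finite_set (finite_II (\max_(k < j) b k)) => i [Ei nAi] /=.
    have [k oi] := oE i Ei; have := Hlev i; rewrite oi => -[Aki _].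
    have kj : (k < j)%N by rewrite ltnNge; apply/negP => /Amono /(_ i Aki).
    apply: leq_trans (leq_bigmax (F := fun k : 'I_j => b k) (Ordinal kj)).
    rewrite ltnNge; apply/negP => /Hb bi.
    by apply: Ei; rewrite /T oi.
  move=> /contrapT FE.
  have c0 : 0 < 2 * `|x| + 1 by rewrite ltr_wpDl// mulr_ge0.
  exists (e / (2 * `|x| + 1)); first by rewrite divr_gt0.
  apply: filterS FE => i /= /contrapT Tx; apply: eV.
  rewrite /= sub0r normrN normrZ gtr0_norm ?divr_gt0//.
  rewrite mulrAC -mulrA gtr_pMr// ltr_pdivrMr// mul1r.
  by apply: le_lt_trans Tx _; rewrite ltrDl.
exists [set y : K^o | `|y| < 1].
  by apply/nbhs_normP; exists 1 => //= y; rewrite /= sub0r normrN.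
move=> U /nbhs_normP[r /= r0 rU].
have r2 : 0 < r / 2 by rewrite divr_gt0.
(* In any layer from [k] on, [T i] exceeds 1 in modulus somewhere in the ball of radius [r], so it
   cannot map [U] into [V]. *)
have [k Hk] := archi r2; exists k => i Aki TU.
have := Hlev i; case oi: (lev i) => [k'|]; last by apply; apply: Amono Aki.
move=> [Ak'i nAk'i]; have kk' : (k <= k')%N.
  by rewrite leqNgt; apply/negP => /Amono /(_ i Aki).
have [_ /(_ i)[x [x1 fx]] _] := Hf k'.
have /TU /= : (T i @` U) (T i ((r / 2) *: x)).
  exists ((r / 2) *: x) => //; apply: rU.
  rewrite /= sub0r normrN normrZ gtr0_norm//; apply: le_lt_trans (_ : r / 2 < r).
    by rewrite ler_piMr// ltW.
  by rewrite ltr_pdivrMr// ltr_pMr// ltr1n.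
rewrite linearZ normrZ gtr0_norm// /T oi => fx1.
suff /(lt_le_trans Hk) /lt_trans /(_ fx1) :
    k%:R * (r / 2) <= r / 2 * `|f k' i x|.
  by rewrite ltxx.
by rewrite mulrC ler_pM2l// (le_trans _ fx)// ler_nat.
Qed.

(** Equicontinuity would put a stationary part of [A k] inside the intersection of all [A j], which
    is then the set sought. *)
Lemma uniform_boundedness_Pplus :
  uniform_boundedness_principle X F -> Pplus_filter F.
Proof.
move=> ubp A Adec sA; apply: contrapT => nB.
have [B _ BA sB|T [Tc Tb [V V0 HV]]] := unbounded_operators Adec.
  by apply: nB; exists B.
have [U U0 FU] := ubp K^o T Tc Tb V V0.
have [k Hk] := HV U U0.
apply: nB; exists (\bigcap_j A j); split.
  apply: stationaryS (stationaryI (sA k) FU) => i [Ai TU] j _.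
  exact: Hk TU j.
by move=> j; apply: sub_finite_set (finite_set0 _) => i [/(_ j I)].
Qed.

(** The operators are built on the sets [I] meets [A k], and the stationary [J] of equicontinuity is
    cut with [A k], a set of [F]. *)
Lemma stationary_uniform_boundedness_weak_Pplus :
  stationary_uniform_boundedness_principle X F -> weak_Pplus_filter F.
Proof.
move=> subp A Adec FA I sI; apply: contrapT => nB.
have AIdec : decreasing_sets (fun k => I `&` A k).
  by move=> k; apply: setIS; apply: Adec.
have [B BI BA sB|T [Tc Tb [V V0 HV]]] := unbounded_operators AIdec.
  apply: nB; exists B; split=> // [i /BI[]//|k].
  apply: sub_finite_set (BA k) => i [Bi nAi]; split=> //.
  by move=> [].
have [U [J [U0 sJ JI HJ]]] := subp K^o T Tc Tb I V sI V0.
have [k Hk] := HV U U0.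
apply: nB; exists (\bigcap_j (I `&` A j)); split.
- apply: stationaryS (stationaryI sJ (FA k)) => i [Ji Ai] j _.
  by apply: (Hk i) => //; [split=> //; exact: JI | exact: HJ].
- by move=> i /(_ 0%N Logic.I)[].
- move=> j; apply: sub_finite_set (finite_set0 _) => i.
  by move=> [/(_ j Logic.I)[]].
Qed.

End Operators.

Theorem lemma4p3 (R : realType) (K : numFieldType)
    (hK : K = R :> numFieldType \/ K = R[i] :> numFieldType)
    (X : normedModType K) (hX : ~ finite_dimensional X)
    (F : set_system nat) (hF : ProperFilter F) (hfree : free_filter F) :
  (uniform_boundedness_principle X F -> Pplus_filter F) /\
  (stationary_uniform_boundedness_principle X F -> weak_Pplus_filter F).
Proof.
have archiR (r : R) : 0 < r -> exists k : nat, 1 < k%:R * r.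
  move=> r0; exists (Num.bound r^-1); rewrite -ltr_pdivrMr// mul1r.
  by apply: archi_boundP; rewrite invr_ge0 ltW.
have [archi Xsmall] : (forall r : K, 0 < r -> exists k : nat, 1 < k%:R * r) /\
    has_weakly_small_functionals X.
  case: hK => hK; subst K; split.
  - exact: archiR.
  - exact: real_has_weakly_small_functionals.
  (* A positive complex number equals its real part, so the archimedean property transfers. *)
  - move=> r r0; have rE : (complex.Re r)%:C%C = r.
      by rewrite RRe_real// gtr0_real.
    have [|k Hk] := archiR (complex.Re r).
      by rewrite -ltcR rE.
    by exists k; rewrite -rE -(rmorph_nat (real_complex R)) -rmorphM
      -(rmorph1 (real_complex R)) ltcR.
  - exact: complex_has_weakly_small_functionals.
split.
- exact: uniform_boundedness_Pplus.
- exact: stationary_uniform_boundedness_weak_Pplus.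
Qed.
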